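(* (Descartes' Theorem) Let $\mathbf{S}\subset\mathbb{R}^3$ be a smooth connected surface. Then $\mathbf{S}$ is a perfect lens (relative to some pair of points $F,F'$) if and only if $\mathbf{S}$ is a connected subset of the ovoid obtained by revolving a cartesian oval around its axis of symmetry.
   Context: Perfect lens: let $\mathbf{S}$ be a smooth connected surface in $\mathbb{R}^3$ and let $F$ and $F'$ be points not in $\mathbf{S}$. The surface $\mathbf{S}$ is called a perfect lens relative to $F$ and $F'$ if, for each point $P$ in $\mathbf{S}$: (1) the normal $\vec{N}$ to $\mathbf{S}$ at $P$ lies in the subspace spanned by the vectors $\overrightarrow{FP}$ and $\overrightarrow{F'P}$; and (2) the sines of the angles $\theta_1,\theta_2$ which $\overrightarrow{FP}$ and $\overrightarrow{F'P}$, respectively, form with that normal are in constant ratio for every point $P$ in $\mathbf{S}$, i.e. there is a constant $n$, independent of $P$, with $\sin\theta_1=n\sin\theta_2$. Cartesian oval: a plane curve which is the locus of points satisfying $d_1+n\,d_2=c$, where $d_1$ and $d_2$ are the distances from the point to two fixed points of the plane, called the foci, and $n$ and $c$ are real constants. If one focus is the origin and the other is $(b,0)$ with $b\geqslant 0$, the equation is $\sqrt{x^2+y^2}+n\sqrt{(b-x)^2+y^2}=c$, which in rationalized form reads $\left[(1-n^2)(x^2+y^2)+2n^2bx+c^2-n^2b^2\right]^2=4c^2(x^2+y^2)$. For $n=\pm1$ the oval is a conic section. The axis of symmetry of a cartesian oval is the line through its foci (the $x$-axis in these coordinates). *)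

(* Defs.v *)
From HB Require Import structures.
From mathcomp Require Import all_boot all_order all_algebra.
From mathcomp Require Import all_classical all_reals all_analysis.

Set Implicit Arguments.
Unset Strict Implicit.
Unset Printing Implicit Defensive.

Import Order.TTheory GRing.Theory Num.Theory.
Import numFieldNormedType.Exports.

Local Open Scope classical_set_scope.
Local Open Scope ring_scope.

(* The library norm `|u| on row vectors is the sup norm; it is used only through
   the topology and differentiability it induces (which are the usual ones).
   All metric notions below are Euclidean. *)

Definition dot (R : realType) (k : nat) (u v : 'rV[R]_k) : R :=
  \sum_(i < k) u 0 i * v 0 i.

Definition enorm (R : realType) (k : nat) (u : 'rV[R]_k) : R :=
  Num.sqrt (dot u u).

(* The unoriented angle in [0, pi]; meaningful for nonzero u and v. *)
Definition angle (R : realType) (k : nat) (u v : 'rV[R]_k) : R :=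
  acos (dot u v / (enorm u * enorm v)).

Fixpoint diff_upto (R : realType) (k m : nat) (U : set 'rV[R]_2)
    (f : 'rV[R]_2 -> 'rV[R]_m.+1) : Prop :=
  (forall q, U q -> differentiable f q) /\
  (if k is k'.+1 then forall v : 'rV[R]_2, diff_upto k' U (fun q => 'D_v f q)
   else True).

(* C^oo on the open set U: the iterated directional derivatives of f of every
   order exist and are Frechet differentiable, hence continuous, on U. *)
Definition smooth_on (R : realType) (m : nat) (U : set 'rV[R]_2)
    (f : 'rV[R]_2 -> 'rV[R]_m.+1) : Prop :=
  forall k, diff_upto k U f.

(* x restricted to U is a regular parametrization of a relatively open part of
   S: a smooth immersion which is a homeomorphism from U onto S `&` V, V open.
   Values of x outside U are irrelevant. *)
Definition regular_chart (R : realType) (S : set 'rV[R]_3)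
    (U : set 'rV[R]_2) (x : 'rV[R]_2 -> 'rV[R]_3) : Prop :=
  [/\ open U,
      smooth_on U x,
      forall q, U q -> injective ('d x q),
      exists2 V : set 'rV[R]_3, open V & x @` U = S `&` V
    & exists2 y : 'rV[R]_3 -> 'rV[R]_2,
        forall q, U q -> y (x q) = q & {within x @` U, continuous y}].

(* Embedded (regular) surface without boundary, not necessarily closed. *)
Definition smooth_surface (R : realType) (S : set 'rV[R]_3) : Prop :=
  forall P, S P -> exists U x, regular_chart S U x /\ (x @` U) P.

(* The tangent plane at P = x q is the range of 'd x q, whichever chart x is
   used. *)
Definition normal_vector (R : realType) (S : set 'rV[R]_3)
    (P N : 'rV[R]_3) : Prop :=
  N != 0 /\
  exists U x q, [/\ regular_chart S U x, U q, x q = P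
                  & forall w, dot N ('d x q w) = 0].

Definition perfect_lens (R : realType) (S : set 'rV[R]_3)
    (F F' : 'rV[R]_3) : Prop :=
  [/\ ~ S F, ~ S F',
      forall P N, S P -> normal_vector S P N ->
        N \in <<[:: P - F; P - F']>>%VS
    & exists n : R, forall P N, S P -> normal_vector S P N ->
        sin (angle (P - F) N) = n * sin (angle (P - F') N)].

Definition cartesian_locus (R : realType) (A B : 'rV[R]_2) (n c : R) :
    set 'rV[R]_2 :=
  [set p | enorm (p - A) + n * enorm (p - B) = c].

(* Cartesian oval with foci (0, 0) and (b, 0).  The last condition excludes the
   only non-curve containing an open set: for b = 0, n = -1, c = 0 the equation
   reads 0 = 0 and the locus is the whole plane. *)
Definition cartesian_oval (R : realType) (C : set 'rV[R]_2) : Prop :=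
  exists b n c : R,
    [/\ 0 <= b, C = cartesian_locus 0 (b *: 'e_0) n c & C <> setT].

Definition orthonormal_frame (R : realType) (e : 'I_3 -> 'rV[R]_3) : Prop :=
  forall i j, dot (e i) (e j) = (i == j)%:R.

(* C, drawn in the plane through O directed by e 0 and e 1, is revolved around
   the line through O directed by e 0. *)
Definition revolve (R : realType) (O : 'rV[R]_3) (e : 'I_3 -> 'rV[R]_3)
    (C : set 'rV[R]_2) : set 'rV[R]_3 :=
  [set P | exists p (phi : R), C p /\
     P = O + p 0 0 *: e 0 + p 0 1 *: (cos phi *: e 1 + sin phi *: e 2%:R)].

Definition cartesian_ovoid (R : realType) (T : set 'rV[R]_3) : Prop :=
  exists O e C, [/\ orthonormal_frame e, cartesian_oval C & T = revolve O e C].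

(* Main.v *)
Require Import Defs.
From HB Require Import structures.
From mathcomp Require Import all_boot all_order all_algebra.
From mathcomp Require Import all_classical all_reals all_analysis.
From mathcomp Require Import ring lra.

(** Write d and d' for the distances to F and F', and u, v for the unit vectors
    from F and F' to a point P of the surface.  The gradients of d and d' on the
    surface are the projections u' and v' of u and v to the tangent plane, and
    the lengths of these projections are the sines of the angles that the two
    rays form with the normal.

    From a lens to an oval.  As the normal is a combination of u and v, the
    vectors u' and v' are proportional, and the law of sines then says that
    u' = n v' or u' = - n v' ([snell_tangent]): at each point one of the
    functions d + n d' and d - n d' is stationary.  The sign could a priori
    change from point to point, but only across points at which u' = v' = 0.  If
    F differs from F' and n is not 0, such a point lies on the axis FF' and the
    surface is normal to the axis there, so these points are isolated
    ([doubly_stationary_isolated]).  A disc without one point is connected, so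
    one sign works near each point ([near_stationary]), and that function is
    locally constant.  The sets of points near which d + n d', resp. d - n d',
    is constant are open, cover the surface, and are disjoint
    ([not_both_locally_constant]); by connectedness one of them is everything
    ([one_focal_constant]).  If F = F' or n = 0, then u' = 0 everywhere and the
    surface lies on a sphere about F.

    From an oval to a lens.  If d + m d' is constant on the surface then
    u + m v is orthogonal to every tangent vector.  If it is not 0 it is a normal
    in the span of the two rays, and comparing areas of parallelograms gives the
    law of sines with ratio |m| ([tangent_snell]).  If u + m v = 0 at some point
    then m is 1 or - 1 and the locus degenerates to the part of the axis between
    the foci or outside them, which contains no surface ([chart_not_in_line]).
    The foci are off the surface because d is not differentiable at F, whereas
    c - m d' is ([focus_off_surface]).  If m = 0 or F = F' the surface
    lies on a sphere about F, hence is a lens with both foci at the centre.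

    Revolving the plane oval about its axis gives the set of points of space
    that satisfy the same equation in the distances to the two foci
    ([revolve_cartesian]), so the theorem is a statement about d + m d'. *)

Set Implicit Arguments.
Unset Strict Implicit.
Unset Printing Implicit Defensive.

Import Order.TTheory GRing.Theory Num.Theory.
Import numFieldNormedType.Exports.

Local Open Scope classical_set_scope.
Local Open Scope ring_scope.

(** * Euclidean vector algebra *)

Section Euclid.
Variables (R : realType) (k : nat).
Implicit Types u v w : 'rV[R]_k.

Lemma dotC u v : dot u v = dot v u.
Proof. by apply: eq_bigr => i _; rewrite mulrC. Qed.

Lemma dotDl u v w : dot (u + v) w = dot u w + dot v w.
Proof. by rewrite /dot -big_split; apply: eq_bigr => i _; rewrite mxE mulrDl. Qed.

Lemma dotZl a u w : dot (a *: u) w = a * dot u w.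
Proof. by rewrite /dot mulr_sumr; apply: eq_bigr => i _; rewrite mxE mulrA. Qed.

Lemma dotDr u v w : dot w (u + v) = dot w u + dot w v.
Proof. by rewrite dotC dotDl !(dotC w). Qed.

Lemma dotZr a u w : dot w (a *: u) = a * dot w u.
Proof. by rewrite dotC dotZl dotC. Qed.

Lemma dotNl u w : dot (- u) w = - dot u w.
Proof. by rewrite -scaleN1r dotZl mulN1r. Qed.

Lemma dotNr u w : dot w (- u) = - dot w u.
Proof. by rewrite dotC dotNl dotC. Qed.

Lemma dot_comb a b u v w : dot w (a *: u + b *: v) = a * dot w u + b * dot w v.
Proof. by rewrite dotDr !dotZr. Qed.

Definition dot_linear := (dotDl, dotDr, dotZl, dotZr, dotNl, dotNr).

Lemma dot_ge0 u : 0 <= dot u u.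
Proof. by apply: sumr_ge0 => i _; rewrite -expr2 sqr_ge0. Qed.

Lemma dot_eq0 u : (dot u u == 0) = (u == 0).
Proof.
apply/eqP/eqP => [|->]; last by rewrite /dot big1 // => i _; rewrite mxE mul0r.
move=> /eqP; rewrite psumr_eq0 => [/allP u0|i _]; last by rewrite -expr2 sqr_ge0.
apply/rowP => i; rewrite mxE.
by have := u0 i (mem_index_enum _); rewrite /= mulf_eq0 orbb => /eqP.
Qed.

Lemma enorm_ge0 u : 0 <= enorm u.
Proof. exact: sqrtr_ge0. Qed.

Lemma enorm_sqr u : enorm u ^+ 2 = dot u u.
Proof. by rewrite sqr_sqrtr ?dot_ge0. Qed.

Lemma enorm_eq0 u : (enorm u == 0) = (u == 0).
Proof. by rewrite -sqrf_eq0 enorm_sqr dot_eq0. Qed.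

Lemma enorm_gt0 u : (0 < enorm u) = (u != 0).
Proof. by rewrite lt_def enorm_ge0 andbT enorm_eq0. Qed.

Lemma enorm0 : enorm (0 : 'rV[R]_k) = 0.
Proof. by apply/eqP; rewrite enorm_eq0. Qed.

Lemma enormZ a u : enorm (a *: u) = `|a| * enorm u.
Proof.
apply/eqP; rewrite -(@eqrXn2 _ 2) ?mulr_ge0 ?enorm_ge0//.
by rewrite exprMn !enorm_sqr !dot_linear real_normK ?num_real// mulrA.
Qed.

(** The squared area of the parallelogram spanned by the two vectors. *)
Definition gram u v := dot u u * dot v v - dot u v ^+ 2.

Lemma gram_ge0 u v : 0 <= gram u v.
Proof.
have [->|v0] := eqVneq v 0.
  have d0 w : dot w 0 = 0 by rewrite -(scale0r 0) dotZr mul0r.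
  by rewrite /gram !d0 mulr0 expr0n subrr.
have vv : 0 < dot v v by rewrite lt_def dot_ge0 dot_eq0 v0.
have := dot_ge0 (dot v v *: u - dot u v *: v); rewrite !dot_linear (dotC v u).
rewrite (_ : _ + _ = dot v v * gram u v); first by rewrite pmulr_rge0.
by rewrite /gram; ring.
Qed.

Lemma gramZr a u v : gram u (a *: v) = a ^+ 2 * gram u v.
Proof. by rewrite /gram !dot_linear; ring. Qed.

Lemma gramZl a u v : gram (a *: u) v = a ^+ 2 * gram u v.
Proof. by rewrite /gram !dot_linear; ring. Qed.

Lemma gramC u v : gram u v = gram v u.
Proof. by rewrite /gram (dotC v); ring. Qed.

(** Equality case of Cauchy-Schwarz. *)
Lemma gram_eq0 u v : v != 0 -> gram u v = 0 ->
  u = (dot u v / dot v v) *: v.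
Proof.
move=> v0 g0.
have vv : dot v v != 0 by rewrite dot_eq0.
apply/eqP; rewrite -subr_eq0 -dot_eq0; apply/eqP.
rewrite !dot_linear (dotC v u) -[RHS](mulr0 (dot v v)^-1) -g0 /gram.
by field.
Qed.

Lemma sin_angle u v : u != 0 -> v != 0 ->
  sin (angle u v) = Num.sqrt (gram u v) / (enorm u * enorm v).
Proof.
move=> u0 v0.
have nu : 0 < enorm u by rewrite enorm_gt0.
have nv : 0 < enorm v by rewrite enorm_gt0.
have e : 1 - (dot u v / (enorm u * enorm v)) ^+ 2 =
    gram u v / (enorm u * enorm v) ^+ 2.
  rewrite /gram -!enorm_sqr; field.
  by rewrite !gt_eqF.
have ge : 0 <= 1 - (dot u v / (enorm u * enorm v)) ^+ 2.
  by rewrite e divr_ge0 ?gram_ge0 ?sqr_ge0.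
rewrite /angle sin_acos; last first.
  set t := _ / _ in ge *; apply/andP; split; nra.
rewrite e sqrtrM ?gram_ge0// sqrtrV ?sqr_ge0// sqrtr_sqr ger0_norm//.
by rewrite mulr_ge0 ?enorm_ge0.
Qed.

End Euclid.

Section Space.
Variable R : realType.
Implicit Types u v w : 'rV[R]_3.

Lemma dot3E u v : dot u v = u 0 0 * v 0 0 + u 0 1 * v 0 1 + u 0 2%:R * v 0 2%:R.
Proof.
rewrite /dot !big_ord_recr big_ord0 /= add0r.
by congr (_ + _ + _); congr (u 0 _ * v 0 _); apply: val_inj.
Qed.

Lemma row3P u v : u 0 0 = v 0 0 -> u 0 1 = v 0 1 -> u 0 2%:R = v 0 2%:R -> u = v.
Proof.
move=> h0 h1 h2; apply/rowP => -[[|[|[|//]]] i].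
- by rewrite (_ : Ordinal i = 0)//; apply: val_inj.
- by rewrite (_ : Ordinal i = 1)//; apply: val_inj.
- by rewrite (_ : Ordinal i = 2%:R)//; apply: val_inj.
Qed.

Definition cross u v : 'rV[R]_3 := \row_i
  [:: u 0 1 * v 0 2%:R - u 0 2%:R * v 0 1;
      u 0 2%:R * v 0 0 - u 0 0 * v 0 2%:R;
      u 0 0 * v 0 1 - u 0 1 * v 0 0]`_i.

Lemma dot_crossl u v : dot (cross u v) u = 0.
Proof. by rewrite dot3E !mxE /=; ring. Qed.

Lemma dot_crossr u v : dot (cross u v) v = 0.
Proof. by rewrite dot3E !mxE /=; ring. Qed.

Lemma dot_cross u v : dot (cross u v) (cross u v) = gram u v.
Proof. by rewrite /gram !dot3E !mxE /=; ring. Qed.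

(** The second and third vectors on the right are, up to the factor [gram u v],
    the dual basis of [u] and [v] in their plane, so the coefficients are scalar
    products with [u] and [v]. *)
Lemma cross_expand u v w : gram u v *: w =
  dot w (cross u v) *: cross u v + dot w u *: (dot v v *: u - dot u v *: v)
  + dot w v *: (dot u u *: v - dot u v *: u).
Proof. by apply: row3P; rewrite /gram !dot3E !mxE /=; ring. Qed.

(** The orthogonal complement of a plane is a line: only the first term of
    [cross_expand] survives. *)
Lemma orth_plane u v w : gram u v != 0 -> dot w u = 0 -> dot w v = 0 ->
  exists a, w = a *: cross u v.
Proof.
move=> g wu wv; exists (dot w (cross u v) / gram u v).
have := cross_expand u v w; rewrite wu wv !scale0r !addr0
  => /(congr1 (fun x => (gram u v)^-1 *: x)).
by rewrite !scalerA mulVf// scale1r mulrC.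
Qed.

End Space.

(** * Locally constant properties *)

(** Both the set [A `&` Z] and its complement in [A] are open in [A]. *)
Lemma connected_locally_constant (T : topologicalType) (A : set T) (Z : set T) :
  connected A ->
  (forall a, A a -> \forall b \near a, A b -> (Z b <-> Z a)) ->
  forall a b, A a -> A b -> Z a -> Z b.
Proof.
move=> cA locZ a b Aa Ab Za.
have openI (Y : set T) :
    (forall c, A c -> \forall d \near c, A d -> (Y d <-> Y c)) ->
    exists2 C, open C & A `&` Y = A `&` C.
  move=> locY; exists (interior [set d | A d -> Y d]).
    exact: open_interior.
  apply/seteqP; split=> [c [Ac Yc]|c [Ac /nbhs_singleton Yc]]; split=> //.
    by have := locY c Ac; apply: filterS => d /[swap] Ad /(_ Ad) [_]; apply.
  exact: Yc.
suff AZ : A `&` Z = A by have [] : (A `&` Z) b by rewrite AZ.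
apply: cA; [by exists a | exact: openI |].
have [|C oC AC] := openI (~` Z).
  move=> c /locZ; apply: filterS => d h /h{h} -[h h'].
  by split=> nZ /[dup]; [move=> /h'|move=> /h].
exists (~` C); first exact: open_closedC.
apply/seteqP; split=> c [Ac Zc]; split=> //.
  by move=> Cc; have [] : (A `&` ~` Z) c by rewrite AC.
by apply: contrapT => nZ; apply: Zc; have [] : (A `&` C) c by rewrite -AC.
Qed.

Lemma connected_cst (T : topologicalType) (V : Type) (A : set T) (f : T -> V) :
  connected A -> (forall a, A a -> \forall b \near a, A b -> f b = f a) ->
  forall a b, A a -> A b -> f b = f a.
Proof.
move=> cA loc a b Aa Ab.
apply: (connected_locally_constant (Z := [set c | f c = f a]) cA _ Aa Ab erefl).
move=> c Ac; apply: filterS (loc c Ac) => d /[apply] fd /=.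
by rewrite fd.
Qed.

Section Plane.
Variable R : realType.
Implicit Types p q h : 'rV[R]_2.

Lemma line_continuous p h : continuous (fun t : R => p + t *: h).
Proof.
move=> t; apply: cvgD; first exact: cvg_cst.
by apply: cvgZr_tmp; exact: cvg_id.
Qed.

Lemma locally_constant_segment (Z : set 'rV[R]_2) p q :
  (forall t : R, 0 <= t <= 1 -> let a := p + t *: (q - p) in
     \forall b \near a, Z b <-> Z a) ->
  Z p -> Z q.
Proof.
move=> loc Zp.
have := @connected_locally_constant R `[0, 1] [set t | Z (p + t *: (q - p))]
  (@segment_connected _ 0 1).
move=> /(_ _ 0 1) /=; rewrite scale0r addr0 scale1r subrKC; apply => //.
- move=> t; rewrite in_itv /= => t01.
  have L : nbhs t [set b | Z (p + b *: (q - p)) <-> Z (p + t *: (q - p))].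
    exact: (@line_continuous p (q - p) t _ (loc t t01)).
  by apply: filterS L => b Zb _.
- by rewrite in_itv /= lexx ler01.
- by rewrite in_itv /= lexx ler01.
Qed.

Lemma ball_segment q0 (r : R) p q (t : R) : 0 <= t <= 1 ->
  ball q0 r p -> ball q0 r q -> ball q0 r (p + t *: (q - p)).
Proof.
rewrite -ball_normE /ball_ /= => /andP[t0 t1] hp hq.
have -> : q0 - (p + t *: (q - p)) = (1 - t) *: (q0 - p) + t *: (q0 - q).
  by apply/rowP => i; rewrite !mxE; ring.
apply: le_lt_trans (ler_normD _ _) _; rewrite !normrZ !ger0_norm ?subr_ge0//.
have [->|tn0] := eqVneq t 0; first by rewrite mul0r addr0 subr0 mul1r.
have tp : 0 < t by rewrite lt_def tn0.
apply: (@lt_le_trans _ _ ((1 - t) * r + t * r)); last by rewrite -mulrDl subrK mul1r.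
by rewrite ler_ltD ?ler_wpM2l ?subr_ge0 ?ltr_pM2l// ltW.
Qed.

Lemma row2P p q : p 0 0 = q 0 0 -> p 0 1 = q 0 1 -> p = q.
Proof.
move=> h0 h1; apply/rowP => -[[|[|//]] i].
- by rewrite (_ : Ordinal i = 0)//; apply: val_inj.
- by rewrite (_ : Ordinal i = 1)//; apply: val_inj.
Qed.

Lemma row2_lt h (r : R) : `|h 0 0| < r -> `|h 0 1| < r -> `|h| < r.
Proof.
move=> h0 h1; have r0 : 0 < r by apply: le_lt_trans h0.
rewrite /Num.Def.normr /= mx_normrE; apply: bigmax_lt => // -[i j] _ /=.
rewrite (ord1 i); case: j => -[|[|//]] j.
- by rewrite (_ : Ordinal j = 0)//; apply: val_inj.
- by rewrite (_ : Ordinal j = 1)//; apply: val_inj.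
Qed.

(** A punctured square is connected: it is covered by four half-squares,
    which are convex and miss the centre; the corners of a smaller square
    connect adjacent halves. *)
Lemma punctured_locally_constant (Z : set 'rV[R]_2) q0 (r : R) :
  0 < r ->
  (forall q, ball q0 r q -> q != q0 -> \forall b \near q, Z b <-> Z q) ->
  forall p q, ball q0 r p -> p != q0 -> ball q0 r q -> q != q0 -> Z p -> Z q.
Proof.
move=> r0 loc.
have half (i : 'I_2) (s : R) p q : ball q0 r p -> ball q0 r q ->
    0 < s * (p 0 i - q0 0 i) -> 0 < s * (q 0 i - q0 0 i) -> Z p -> Z q.
  move=> Bp Bq sp sq; apply: locally_constant_segment => t t01 /=.
  apply: loc; first exact: ball_segment.
  apply/eqP => /rowP /(_ i) /eqP; rewrite !mxE -subr_eq0 => /eqP e.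
  have : s * (p 0 i + t * (q 0 i - p 0 i) - q0 0 i) = 0 by rewrite e mulr0.
  case/andP: t01 => t0 t1.
  rewrite (_ : _ * _ = (1 - t) * (s * (p 0 i - q0 0 i)) +
                       t * (s * (q 0 i - q0 0 i))); last by ring.
  by move: sp sq; set u := s * _; set v := s * _ => *; nra.
pose corner (s t : R) : 'rV[R]_2 :=
  q0 + (r / 2) *: (s *: delta_mx 0 0 + t *: delta_mx 0 1).
have corner0 s t : corner s t 0 0 - q0 0 0 = r / 2 * s.
  by rewrite /corner !mxE /=; ring.
have corner1 s t : corner s t 0 1 - q0 0 1 = r / 2 * t.
  by rewrite /corner !mxE /=; ring.
have cornerB s t : `|s| = 1 -> `|t| = 1 -> ball q0 r (corner s t).
  move=> hs ht; rewrite -ball_normE /ball_ /= distrC; apply: row2_lt.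
    rewrite (_ : (corner s t - q0) 0 0 = r / 2 * s); last by rewrite !mxE /=; ring.
    by rewrite normrM hs gtr0_norm; lra.
  rewrite (_ : (corner s t - q0) 0 1 = r / 2 * t); last by rewrite !mxE /=; ring.
  by rewrite normrM ht gtr0_norm; lra.
have sgM (a : R) : a != 0 -> 0 < Num.sg a * a.
  by move=> a0; rewrite -normrEsg normr_gt0.
have sg1 (a : R) : a != 0 -> `|Num.sg a| = 1.
  by move=> a0; rewrite normr_sg a0.
have n1 : `|1 : R| = 1 by rewrite normr1.
have cs (s : R) : `|s| = 1 -> 0 < s * (r / 2 * s).
  move=> hs; rewrite mulrCA -expr2 -real_normK ?num_real// hs; lra.
have to_corner p : ball q0 r p -> p != q0 ->
    (Z p -> Z (corner 1 1)) /\ (Z (corner 1 1) -> Z p).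
  move=> Bp pq.
  have [e|d0] := eqVneq (p 0 0 - q0 0 0) 0.
  have [e'|d1] := eqVneq (p 0 1 - q0 0 1) 0.
    by case/negP: pq; apply/eqP/row2P; apply/eqP; rewrite -subr_eq0 ?e ?e'.
    have s1 := sg1 _ d1; set s := Num.sg _ in s1.
    split=> Zp.
      apply: (half 0 1 (corner 1 s)); rewrite ?corner0 ?cs//; try exact: cornerB.
      by apply: (half 1 s p); rewrite ?corner1 ?cs ?sgM//; exact: cornerB.
    apply: (half 1 s (corner 1 s)); rewrite ?corner1 ?cs ?sgM//; try exact: cornerB.
    by apply: (half 0 1 (corner 1 1)); rewrite ?corner0 ?cs//; exact: cornerB.
  have s1 := sg1 _ d0; set s := Num.sg _ in s1.
  split=> Zp.
    apply: (half 1 1 (corner s 1)); rewrite ?corner1 ?cs//; try exact: cornerB.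
    by apply: (half 0 s p); rewrite ?corner0 ?cs ?sgM//; exact: cornerB.
  apply: (half 0 s (corner s 1)); rewrite ?corner0 ?cs ?sgM//; try exact: cornerB.
  by apply: (half 1 1 (corner 1 1)); rewrite ?corner1 ?cs//; exact: cornerB.
move=> p q Bp pq Bq qq Zp.
by apply: (to_corner q Bq qq).2; apply: (to_corner p Bp pq).1.
Qed.

End Plane.

(** * Derivatives along lines *)

Section Calculus.
Variable R : realType.
Implicit Types p q h : 'rV[R]_2.

Lemma is_derive_line (V W : normedModType R) (f : V -> W) (p h : V) (t : R) (l : W) :
  is_derive (p + t *: h) h f l -> is_derive t 1 (fun s : R => f (p + s *: h)) l.
Proof.
have e : (fun u : R => u^-1 *: (((fun s : R => f (p + s *: h)) \o shift t) (u *: 1)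
             - f (p + t *: h))) =
         (fun u : R => u^-1 *: ((f \o shift (p + t *: h)) (u *: h) - f (p + t *: h))).
  apply/funext => u /=; congr (_ *: (f _ - _)).
  by rewrite [u *: 1]mulr1 scalerDl addrCA.
move=> [df <-]; apply: DeriveDef; last by rewrite /derive e.
by move: df; rewrite /derivable e.
Qed.

Lemma is_derive_coord (V : normedModType R) (m : nat) (f : V -> 'rV[R]_m.+1) (q h : V) i :
  differentiable f q -> is_derive q h (fun a => f a 0 i) ('d f q h 0 i).
Proof.
move=> df; have dd := diff_derivable (v := h) df.
apply: DeriveDef; first by move/derivable_mxP : dd; apply.
by rewrite -deriveE// derive_mx// mxE.
Qed.

Lemma is_derive_enorm (m : nat) (c : R -> 'rV[R]_m) (t : R) (l : 'rV[R]_m) :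
  (forall i, is_derive t 1 (fun s => c s 0 i) (l 0 i)) -> c t != 0 ->
  is_derive t 1 (fun s => enorm (c s)) (dot (c t) l / enorm (c t)).
Proof.
move=> dc c0.
have dd : is_derive t 1 (fun s => dot (c s) (c s)) (2 * dot (c t) l).
  have := @is_derive_sum _ _ _ m (fun i => (fun s => c s 0 i) * (fun s => c s 0 i)) t 1
    (fun i => c t 0 i *: l 0 i + c t 0 i *: l 0 i) (fun i => is_deriveM (dc i) (dc i)).
  set f := (X in is_derive _ _ X _); set d := (X in is_derive _ _ _ X).
  rewrite (_ : f = (fun s => dot (c s) (c s))); last first.
    apply/funext => s; rewrite /f fct_sumE.
    by apply: eq_bigr.
  rewrite (_ : d = 2 * dot (c t) l)// /d /dot mulr_sumr.
  by apply: eq_bigr => i _; rewrite /GRing.scale /=; ring.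
have pos : 0 < dot (c t) (c t) by rewrite -enorm_sqr exprn_gt0// enorm_gt0.
have := @is_derive1_comp _ Num.sqrt (fun s => dot (c s) (c s)) t _ _
  (is_derive1_sqrt pos) dd.
rewrite -/(enorm (c t)) => H; apply: is_derive_eq H _.
rewrite /GRing.scale /=; field.
by rewrite enorm_eq0.
Qed.

(** The derivative in the direction [h] of the distance to [F] along [x]
    ([is_derive_dist]).  It is written with the directional derivative and not
    with the differential of [x] so that it is visibly continuous in [q]. *)
Definition slope (x : 'rV[R]_2 -> 'rV[R]_3) (F : 'rV[R]_3) q h : R :=
  dot (x q - F) ('D_h x q) / enorm (x q - F).

Lemma is_derive_dist (x : 'rV[R]_2 -> 'rV[R]_3) F p h (t : R) :
  differentiable x (p + t *: h) -> x (p + t *: h) != F ->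
  is_derive t 1 (fun s => enorm (x (p + s *: h) - F)) (slope x F (p + t *: h) h).
Proof.
move=> dx xF; rewrite /slope; apply: (@is_derive_enorm 3 (fun s => x (p + s *: h) - F)).
  move=> i; have H := is_derive_line (is_derive_coord h i dx).
  rewrite (_ : (fun s : R => _) = (fun s => x (p + s *: h) 0 i) - cst (F 0 i)).
    by rewrite deriveE// -[X in is_derive _ _ _ X]subr0; apply: is_deriveB.
  by apply/funext => s /=; rewrite !mxE.
by rewrite subr_eq0.
Qed.

Lemma dot_continuous (T : topologicalType) (m : nat) (f g : T -> 'rV[R]_m) (a : T) :
  {for a, continuous f} -> {for a, continuous g} ->
  {for a, continuous (fun b => dot (f b) (g b))}.
Proof.
move=> cf cg; rewrite /dot.
apply: (@cvg_big _ _ +%R) => [|i _]; first exact: add_continuous.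
apply: cvgM.
  apply: (@continuous_comp _ _ _ f (fun M : 'rV[R]_m => M 0 i) _ cf).
  exact: coord_continuous.
apply: (@continuous_comp _ _ _ g (fun M : 'rV[R]_m => M 0 i) _ cg).
exact: coord_continuous.
Qed.

Lemma normalized_dot_continuous (T : topologicalType) (m : nat)
    (f g : T -> 'rV[R]_m) (F : 'rV[R]_m) (a : T) :
  {for a, continuous f} -> {for a, continuous g} -> f a != F ->
  {for a, continuous (fun b => dot (f b - F) (g b) / enorm (f b - F))}.
Proof.
move=> cf cg faF.
have cfF : {for a, continuous (fun b => f b - F)}.
  by apply: cvgB => //; exact: cvg_cst.
apply: cvgM; first exact: (dot_continuous cfF cg).
apply: cvgV; first by rewrite enorm_eq0 subr_eq0.
apply: (@continuous_comp _ _ _ _ (@Num.sqrt R) _ (dot_continuous cfF cfF)).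
exact: sqrt_continuous.
Qed.

(** Mean value theorem along the segments from the centre. *)
Lemma constant_on_ball (f : 'rV[R]_2 -> R) q0 (r : R) :
  (forall p h (t : R), ball q0 r (p + t *: h) ->
     is_derive t 1 (fun s : R => f (p + s *: h)) 0) ->
  forall q, ball q0 r q -> f q = f q0.
Proof.
move=> df q Bq.
have r0 : 0 < r by apply: le_lt_trans (normr_ge0 (q0 - q)) _; rewrite -ball_normE in Bq.
have D (t : R) : 0 <= t <= 1 -> is_derive t 1 (fun s : R => f (q0 + s *: (q - q0))) 0.
  move=> t01; apply: df; apply: ball_segment => //; exact: ballxx.
have := @MVT_segment R (fun s : R => f (q0 + s *: (q - q0))) (fun=> 0) 0 1 ler01.
case=> [t||t _].
- by rewrite in_itv /= => /andP[t0 t1]; apply: D; rewrite !ltW.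
- apply: derivable_within_continuous => t; rewrite in_itv /= => /D d.
  exact: ex_derive.
- by rewrite scale0r addr0 scale1r subrKC mul0r => /eqP; rewrite subr_eq0 => /eqP.
Qed.

(** Both [f - g] and [f + g] have a minimum at [0], so the derivative of [g]
    there equals that of [f] and also its opposite. *)
Lemma derive_dominated (f g : R -> R) (d : R) : 0 < d ->
  (forall t, - d < t < d -> [/\ derivable f t 1, derivable g t 1 & `|g t| <= f t]) ->
  f 0 = 0 -> 'D_1 g 0 = 0.
Proof.
move=> d0 H f0.
have [|df dg] := H 0; first lra.
rewrite f0 normr_le0 => /eqP g0.
have I0 : 0 \in `]- d, d[%R by rewrite in_itv /=; lra.
have leN : - d <= d by lra.
have m1 : is_derive (0 : R) 1 (f - g) 0.
  apply: (derive1_at_min leN) I0 _ => t; rewrite in_itv /= => /H[dft dgt gt].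
    exact: (derivableB dft dgt).
  by move: gt; rewrite !fctE f0 g0 ler_norml; lra.
have m2 : is_derive (0 : R) 1 (f + g) 0.
  apply: (derive1_at_min leN) I0 _ => t; rewrite in_itv /= => /H[dft dgt gt].
    exact: (derivableD dft dgt).
  by move: gt; rewrite !fctE f0 g0 ler_norml; lra.
case: m1 => _; rewrite (deriveB df dg) => e1.
case: m2 => _; rewrite (deriveD df dg) => e2.
lra.
Qed.

End Calculus.

(** * Charts of a surface *)

Section Chart.
Variables (R : realType) (S : set 'rV[R]_3) (U : set 'rV[R]_2).
Variable x : 'rV[R]_2 -> 'rV[R]_3.
Hypothesis chart : regular_chart S U x.
Implicit Types (q h : 'rV[R]_2) (N F : 'rV[R]_3).

Lemma chart_differentiable q : U q -> differentiable x q.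
Proof. by case: chart => _ sx _ _ _; case: (sx 0%N) => + _; apply. Qed.

Lemma chart_dE q h : U q -> 'D_h x q = 'd x q h.
Proof. by move=> Uq; rewrite deriveE//; exact: chart_differentiable. Qed.

Lemma chart_continuous q : U q -> {for q, continuous x}.
Proof. by move=> /chart_differentiable/differentiable_continuous. Qed.

Lemma chart_D_continuous q h : U q -> {for q, continuous ('D_h x)}.
Proof.
move=> Uq; case: chart => _ sx _ _ _; have [_ /(_ h)[/(_ _ Uq) + _]] := sx 1%N.
exact: differentiable_continuous.
Qed.

Lemma chart_open : open U.
Proof. by case: chart. Qed.

Lemma chart_near q : U q -> \forall a \near q, U a.
Proof. by move=> Uq; apply: open_nbhs_nbhs; split=> //; exact: chart_open. Qed.

Lemma chart_mem q : U q -> S (x q).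
Proof.
by case: chart => _ _ _ [V _ xU] _ Uq; have [] : (S `&` V) (x q) by rewrite -xU; exists q.
Qed.

Lemma chart_neq q F : ~ S F -> U q -> x q != F.
Proof. by move=> SF /chart_mem Sq; apply/eqP => e; rewrite e in Sq. Qed.

(** The inverse of a chart is continuous, so a chart is an open map to the
    surface. *)
Lemma near_chart q (A : set 'rV[R]_3) : U q ->
  (\forall a \near q, A (x a)) -> \forall P \near x q, S P -> A P.
Proof.
case: chart => _ _ _ [V oV xU] [y yx cy] Uq Aq.
have Vq : V (x q) by have [] : (S `&` V) (x q) by rewrite -xU; exists q.
have xUq : (x @` U) (x q) by exists q.
have cyq : y @ within (x @` U) (nbhs (x q)) --> y (x q).
  exact: ((subspace_continuousP _ _).1 cy (x q) xUq).
rewrite (yx q Uq) in cyq.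
have H' : \forall P \near x q, (x @` U) P -> A (x (y P)) by exact: (cyq _ Aq).
have H'' : \forall P \near x q, V P by apply: open_nbhs_nbhs; split.
apply: filterS2 H' H'' => P AP VP SP.
have xUP : (x @` U) P by rewrite xU.
by have := AP xUP; case: xUP => a Ua <-; rewrite yx.
Qed.

Definition tangent0 q := 'D_(delta_mx 0 0) x q.
Definition tangent1 q := 'D_(delta_mx 0 1) x q.

Lemma tangent_decomp q h : U q ->
  'D_h x q = h 0 0 *: tangent0 q + h 0 1 *: tangent1 q.
Proof.
move=> Uq; rewrite /tangent0 /tangent1 !chart_dE// -!linearZ -linearD; congr ('d x q _).
by apply: row2P; rewrite !mxE /=; ring.
Qed.

(** This is the injectivity of the differential. *)
Lemma tangent_independent q : U q -> gram (tangent0 q) (tangent1 q) != 0.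
Proof.
move=> Uq; have inj : injective ('d x q) by case: chart => _ _ + _ _; apply.
have inj0 h : 'D_h x q = 0 -> h = 0.
  by rewrite chart_dE// -(linear0 ('d x q)) => /inj.
have t1 : tangent1 q != 0.
  apply/eqP => /inj0 /rowP /(_ 1) /eqP; rewrite !mxE /=.
  by rewrite oner_eq0.
apply/eqP => /(gram_eq0 t1); set a := _ / _ => e.
have /inj0 /rowP /(_ 0) /eqP : 'D_(delta_mx 0 0 - a *: delta_mx 0 1) x q = 0.
  rewrite tangent_decomp// e scalerA -scalerDl !mxE /=.
  by rewrite (_ : _ + _ = 0) ?scale0r//; ring.
by rewrite !mxE /= mulr0 subr0 oner_eq0.
Qed.

Lemma normal_chart q N : U q -> N != 0 ->
  dot N (tangent0 q) = 0 -> dot N (tangent1 q) = 0 -> normal_vector S (x q) N.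
Proof.
move=> Uq N0 n0 n1; split=> //; exists U, x, q; split=> // w.
by rewrite -(chart_dE w Uq) (tangent_decomp w Uq) dot_comb n0 n1 !mulr0 addr0.
Qed.

Lemma slope_chart_continuous q F h : U q -> x q != F ->
  {for q, continuous (fun a => slope x F a h)}.
Proof.
move=> Uq; apply: normalized_dot_continuous; first exact: chart_continuous.
exact: chart_D_continuous.
Qed.

(** If [x a - x q] is a multiple of [D], which is normal at [q], then its
    tangential part vanishes; but that part is the injective linear map
    ['d x q] applied to [a - q], up to an error that is small compared with
    [a - q].  The tangential coordinates are read off with the vectors [E'] and
    [G'] of the tangent plane. *)
Lemma isolated_orthogonal_line q (D : 'rV[R]_3) : U q ->
  dot D (tangent0 q) = 0 -> dot D (tangent1 q) = 0 ->
  \forall a \near q, forall s : R, x a - x q = s *: D -> a = q.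
Proof.
move=> Uq D0 D1.
have g := tangent_independent Uq.
have dec h := tangent_decomp h Uq.
move: (tangent0 q) (tangent1 q) => E G in D0 D1 g dec *.
(* up to the factor [gram E G] these are the dual basis of [E] and [G] *)
pose E' := dot G G *: E - dot E G *: G; pose G' := dot E E *: G - dot E G *: E.
have E'D (s : R) : dot E' (s *: D) = 0.
  by rewrite /E' !dot_linear !(dotC _ D) D0 D1; ring.
have G'D (s : R) : dot G' (s *: D) = 0.
  by rewrite /G' !dot_linear !(dotC _ D) D0 D1; ring.
have dotE' h : dot E' ('D_h x q) = gram E G * h 0 0.
  by rewrite dec /E' /gram !dot_linear (dotC G E); ring.
have dotG' h : dot G' ('D_h x q) = gram E G * h 0 1.
  by rewrite dec /G' /gram !dot_linear (dotC G E); ring.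
pose C (v : 'rV[R]_3) : R := \sum_(i < 3) `|v 0 i|.
have CB (v w : 'rV[R]_3) : `|dot v w| <= C v * `|w|.
  rewrite /dot /C mulr_suml (le_trans (ler_norm_sum _ _ _))//.
  apply: ler_sum => i _; rewrite normrM ler_wpM2l//.
  by rewrite [leRHS]/Num.Def.normr /= mx_normrE; exact: (le_bigmax _ _ (0, i)).
have C0 v : 0 <= C v by apply: sumr_ge0.
(* small enough for each coordinate of [a - q] to be at most half of its norm *)
pose e := `|gram E G| / (C E' + C G' + 1) / 2.
have K0 : 0 < C E' + C G' + 1 by rewrite ltr_wpDl ?addr_ge0.
have g0 : 0 < `|gram E G| by rewrite normr_gt0.
have e0 : 0 < e by rewrite !divr_gt0.
have small : \forall h \near (0 : 'rV[R]_2),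
    `|x (h + q) - x q - 'D_h x q| <= e * `|h|.
  have dx := chart_differentiable Uq.
  have := diff_locallyx dx; set o := 'o _ => ho.
  have : \forall h \near (0 : 'rV[R]_2), `|o h| <= e * `|h|.
    exact: (littleoP o e0).
  apply: filterS => h; rewrite ho (chart_dE _ Uq).
  by rewrite -[_ - _ - _]addrA -opprD addrAC subrr add0r.
have half (v : 'rV[R]_3) h (s : R) (u : R) : dot v ('D_h x q) = gram E G * u ->
    dot v (s *: D) = 0 -> x (h + q) - x q = s *: D ->
    `|x (h + q) - x q - 'D_h x q| <= e * `|h| -> C v <= C E' + C G' + 1 -> h != 0 ->
    `|u| < `|h|.
  move=> vh vD -> + vC h0 => /(ler_wpM2l (C0 v)) /(le_trans (CB _ _)).
  rewrite dotDr dotNr vD vh sub0r normrN normrM => /le_trans ule.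
  have hp : 0 < `|h| by rewrite normr_gt0.
  have : `|gram E G| * `|u| <= `|gram E G| / 2 * `|h|.
    apply: ule; rewrite mulrA ler_pM2r// (_ : `|gram E G| / 2 = (C E' + C G' + 1) * e).
      by rewrite ler_pM2r.
    by rewrite /e; field; rewrite gt_eqF.
  by nra.
have : \forall h \near (0 : 'rV[R]_2), forall s : R, x (h + q) - x q = s *: D -> h = 0.
  apply: filterS small => h hs s e1; apply/eqP/negPn/negP => h0.
  have := row2_lt (half _ _ _ _ (dotE' h) (E'D s) e1 hs _ h0)
                  (half _ _ _ _ (dotG' h) (G'D s) e1 hs _ h0).
  by rewrite ltxx => F; apply: notF; apply: F; have := C0 E'; have := C0 G'; lra.
rewrite (near_shift q 0); apply: filterS => a /= H s.
by have := H s; rewrite sub0r subrK => /[apply] /eqP; rewrite subr_eq0 => /eqP.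
Qed.

End Chart.

(** * The law of sines *)

Section Snell.
Variable R : realType.
Implicit Types a b N w : 'rV[R]_3.

Lemma mem_span2P a b N : reflect (exists s t : R, N = s *: a + t *: b)
  (N \in <<[:: a; b]>>%VS).
Proof.
rewrite span_cons span_seq1; apply: (iffP idP) => [|[s [t ->]]].
  by case/memv_addP => u /vlineP[s ->] [v /vlineP[t ->] ->]; exists s, t.
by apply: memv_add; apply/vlineP; [exists s|exists t].
Qed.

Lemma sqr_sin_angle a N : a != 0 -> N != 0 ->
  sin (angle a N) ^+ 2 = gram ((enorm a)^-1 *: a) N / dot N N.
Proof.
move=> a0 N0; rewrite sin_angle// gramZl expr_div_n sqr_sqrtr ?gram_ge0//.
rewrite exprMn (enorm_sqr N) exprVn; field.
by rewrite dot_eq0 N0 enorm_eq0 a0.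
Qed.

(** A linear relation [N = s u + t v] projects to [s u' + t v' = 0] on the
    plane orthogonal to [N], so the projections [u'] and [v'] are proportional;
    the law of sines is the ratio of their lengths, and determines the factor
    of proportionality up to sign. *)
Lemma snell_tangent a b N (n : R) : a != 0 -> b != 0 -> N != 0 ->
  N \in <<[:: a; b]>>%VS -> sin (angle a N) = n * sin (angle b N) ->
  exists e : bool, forall w, dot N w = 0 ->
    dot a w / enorm a = (-1) ^+ e * n * (dot b w / enorm b).
Proof.
move=> a0 b0 N0 /mem_span2P[s [t defN]] sinE.
have na : enorm a != 0 by rewrite enorm_eq0.
have nb : enorm b != 0 by rewrite enorm_eq0.
have NN : dot N N != 0 by rewrite dot_eq0.
pose u := (enorm a)^-1 *: a; pose v := (enorm b)^-1 *: b.
have uE w : dot a w / enorm a = dot u w by rewrite dotZl mulrC.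
have vE w : dot b w / enorm b = dot v w by rewrite dotZl mulrC.
have gE : gram u N = n ^+ 2 * gram v N.
  have := congr1 (fun z => z ^+ 2 * dot N N) sinE.
  by rewrite exprMn !sqr_sin_angle// -[n ^+ 2 * _ * _]mulrA !divfK.
have {}defN : N = (s * enorm a) *: u + (t * enorm b) *: v.
  by rewrite defN /u /v !scalerA !mulfK.
clearbody u v; move: (s * _) (t * _) defN => {}s {}t defN.
(* if [v] is normal then so is [u], by the law of sines *)
have degenerate : gram v N = 0 -> forall w, dot N w = 0 -> dot u w = 0 /\ dot v w = 0.
  move=> gv w Nw; have gu : gram u N = 0 by rewrite gE gv mulr0.
  by rewrite (gram_eq0 N0 gv) (gram_eq0 N0 gu) !dotZl Nw !mulr0.
have [gv|gv] := eqVneq (gram v N) 0.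
  by exists false => w Nw; rewrite uE vE; have [-> ->] := degenerate gv w Nw; rewrite !mulr0.
have [s0|s0] := eqVneq s 0.
  case/eqP: gv; rewrite defN s0 scale0r add0r gramZr /gram; ring.
pose k := - t / s.
have defu : u = s^-1 *: N + k *: v.
  rewrite defN scalerDr !scalerA -addrA -scalerDl mulVf// scale1r /k.
  by rewrite (_ : s^-1 * t + - t / s = 0) ?scale0r ?addr0//; field.
have : (k ^+ 2 - n ^+ 2) * gram v N = 0.
  rewrite mulrBl -gE defu addrC /gram !dot_linear (dotC N v); ring.
move=> /eqP; rewrite mulf_eq0 (negbTE gv) orbF subr_eq0 eqf_sqr => kn.
have ku w : dot N w = 0 -> dot u w = k * dot v w.
  by move=> Nw; rewrite defu dotDl !dotZl Nw mulr0 add0r.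
by case/orP: kn => /eqP kn; [exists false|exists true] => w Nw;
  rewrite uE vE ku// kn ?expr0 ?expr1 ?mul1r ?mulN1r.
Qed.

(** Conversely, a common normal direction of the form [u + m v] makes the law
    of sines hold with ratio [|m|]: the areas of the parallelograms of [u] and
    of [v] with [u + m v] are [|m|] and [1] times the one of [u] and [v]. *)
Lemma tangent_snell a b N (s m : R) : a != 0 -> b != 0 -> N != 0 ->
  N = s *: ((enorm a)^-1 *: a + m *: ((enorm b)^-1 *: b)) ->
  N \in <<[:: a; b]>>%VS /\ sin (angle a N) = `|m| * sin (angle b N).
Proof.
move=> a0 b0 N0 defN; split.
  apply/mem_span2P; exists (s * (enorm a)^-1), (s * m * (enorm b)^-1).
  by rewrite defN scalerDr !scalerA ?mulrA.
apply/eqP; rewrite -(@eqrXn2 _ 2)//; last 2 first.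
- by rewrite sin_angle// divr_ge0 ?mulr_ge0 ?enorm_ge0 ?sqrtr_ge0.
- by rewrite sin_angle// mulr_ge0// divr_ge0 ?mulr_ge0 ?enorm_ge0 ?sqrtr_ge0.
rewrite exprMn !sqr_sin_angle// mulrA real_normK ?num_real//; apply/eqP.
congr (_ / _); rewrite defN; move: (_ *: a) (_ *: b) => u v.
rewrite !gramZr mulrCA; congr (_ * _).
by rewrite /gram !dot_linear (dotC v u); ring.
Qed.

End Snell.

(** * Stationary focal distances *)

Section FocalDistances.
Variables (R : realType) (S : set 'rV[R]_3) (U : set 'rV[R]_2).
Variable x : 'rV[R]_2 -> 'rV[R]_3.
Hypothesis chart : regular_chart S U x.
Implicit Types (q h : 'rV[R]_2) (F : 'rV[R]_3).

Lemma is_derive_focal q h F F' (m t : R) : U (q + t *: h) ->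
  x (q + t *: h) != F -> x (q + t *: h) != F' ->
  is_derive t 1
    (fun s => enorm (x (q + s *: h) - F) + m * enorm (x (q + s *: h) - F'))
    (slope x F (q + t *: h) h + m * slope x F' (q + t *: h) h).
Proof.
move=> Uq qF qF'; have dx := chart_differentiable chart Uq.
have D := is_derive_dist dx qF; have D' := is_derive_dist dx qF'.
exact: (is_deriveD D (is_deriveZ m D')).
Qed.

Lemma focal_cst_slope q F F' (m c : R) : U q -> x q != F -> x q != F' ->
  (\forall a \near q, enorm (x a - F) + m * enorm (x a - F') = c) ->
  forall h, slope x F q h + m * slope x F' q h = 0.
Proof.
move=> Uq qF qF' focal_cst h.
have e : q + 0 *: h = q by rewrite scale0r addr0.
have := @is_derive_focal q h F F' m 0; rewrite e => /(_ Uq qF qF') [_ <-].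
have L : \forall t \near (0 : R), enorm (x (q + t *: h) - F) +
    m * enorm (x (q + t *: h) - F') = c.
  have L0 : nbhs (q + 0 *: h)
      [set a | enorm (x a - F) + m * enorm (x a - F') = c] by rewrite e.
  exact: (@line_continuous R q h 0 _ L0).
by rewrite (near_eq_derive (g := cst c) _ L) derive_cst.
Qed.

Lemma slope_focal_cst q F F' (m : R) :
  (\forall a \near q, [/\ U a, x a != F, x a != F' &
     forall h, slope x F a h + m * slope x F' a h = 0]) ->
  \forall a \near q, enorm (x a - F) + m * enorm (x a - F') =
                     enorm (x q - F) + m * enorm (x q - F').
Proof.
move=> /nbhs_ballP[r /= r0 Br]; apply/nbhs_ballP; exists r => //= a Ba.
apply: (constant_on_ball (f := fun a => enorm (x a - F) + m * enorm (x a - F')) _ Ba).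
by move=> p h t /Br[Ua aF aF' /(_ h) <-]; exact: is_derive_focal.
Qed.

End FocalDistances.

(** The plane has no isolated points. *)
Lemma exists_near_neq (R : realType) (q : 'rV[R]_2) (A : set 'rV[R]_2) :
  (\forall a \near q, A a) -> exists2 a, A a & a != q.
Proof.
move=> /nbhs_ballP[r /= r0 Br]; exists (q + (r / 2) *: delta_mx 0 0).
  apply: Br; rewrite -ball_normE /ball_ /= opprD addrA subrr sub0r normrN.
  apply: row2_lt; rewrite !mxE /= ?mulr1 ?mulr0 ?normr0// gtr0_norm; lra.
rewrite -subr_eq0 addrAC subrr add0r; apply/eqP => /rowP /(_ 0) /eqP.
by rewrite !mxE /= mulr1 mulf_eq0 invr_eq0 pnatr_eq0 orbF gt_eqF.
Qed.

Lemma near_comb_neq0 (R : realType) (T : topologicalType) (f g : T -> R) (m : R) (a : T) :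
  {for a, continuous f} -> {for a, continuous g} -> f a + m * g a != 0 ->
  \forall b \near a, f b + m * g b != 0.
Proof.
move=> cf cg; apply: cvgr_neq0.
by apply: cvgD; [exact: cf | apply: cvgM; [exact: cvg_cst | exact: cg]].
Qed.

Section Lens.
Variables (R : realType) (S : set 'rV[R]_3) (F F' : 'rV[R]_3) (n : R).
Hypotheses (SF : ~ S F) (SF' : ~ S F').
Hypothesis coplanar : forall P N, S P -> normal_vector S P N ->
  N \in <<[:: P - F; P - F']>>%VS.
Hypothesis snell : forall P N, S P -> normal_vector S P N ->
  sin (angle (P - F) N) = n * sin (angle (P - F') N).

Section LensChart.
Variables (U : set 'rV[R]_2) (x : 'rV[R]_2 -> 'rV[R]_3).
Hypothesis chart : regular_chart S U x.
Implicit Types (q h : 'rV[R]_2).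

(** The boolean is the sign in [d + n d'] or [d - n d']. *)
Definition stationary (e : bool) : set 'rV[R]_2 :=
  [set q | forall h, slope x F q h + (-1) ^+ e * n * slope x F' q h = 0].

Lemma cross_tangent_normal q : U q ->
  normal_vector S (x q) (cross (tangent0 x q) (tangent1 x q)).
Proof.
move=> Uq; apply: (normal_chart chart Uq); last 2 first.
- exact: dot_crossl.
- exact: dot_crossr.
by rewrite -dot_eq0 dot_cross (tangent_independent chart).
Qed.

Lemma lens_stationary q : U q -> exists e, stationary e q.
Proof.
move=> Uq; have Sq := chart_mem chart Uq; have Nq := cross_tangent_normal Uq.
have xF : x q - F != 0 by rewrite subr_eq0 (chart_neq chart SF).
have xF' : x q - F' != 0 by rewrite subr_eq0 (chart_neq chart SF').
have [e He] := snell_tangent xF xF' Nq.1 (coplanar Sq Nq) (snell Sq Nq).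
exists (~~ e) => h; rewrite /slope He; first by rewrite signrN !mulNr subrr.
by rewrite (tangent_decomp chart h Uq) dot_comb dot_crossl dot_crossr !mulr0 addr0.
Qed.

Lemma near_not_stationary q e : U q -> ~ stationary e q ->
  \forall a \near q, ~ stationary e a.
Proof.
move=> Uq /existsNP[h /eqP neq0].
have cF := slope_chart_continuous chart (h := h) Uq (chart_neq chart SF Uq).
have cF' := slope_chart_continuous chart (h := h) Uq (chart_neq chart SF' Uq).
by apply: filterS (near_comb_neq0 cF cF' neq0) => a /eqP an /(_ h).
Qed.

(** Both conditions are closed and at least one holds at each parameter, so where
    only one holds neither can change. *)
Lemma stationary_locally_constant q e : U q ->
  ~ (stationary true q /\ stationary false q) ->
  \forall a \near q, stationary e a <-> stationary e q.
Proof.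
move=> Uq nbad.
have [stq|nstq] := pselect (stationary e q); last first.
  by apply: filterS (near_not_stationary Uq nstq) => a na; split.
have /(near_not_stationary Uq) : ~ stationary (~~ e) q.
  by move=> nst; apply: nbad; case: e stq nst.
apply: filterS2 (chart_near chart Uq) => a Ua na; split=> // _.
have [e' st'] := lens_stationary Ua.
by case: (eqVneq e' e) st' => [->//|]; case: e e' na {stq} => -[] na.
Qed.

Hypotheses (FF' : F != F') (n0 : n != 0).

Lemma doubly_stationary q h : stationary true q -> stationary false q ->
  slope x F q h = 0 /\ slope x F' q h = 0.
Proof.
move=> /(_ h) + /(_ h); rewrite expr0 expr1 mul1r mulN1r mulNr => e1 e2.
have : slope x F q h = 0 by lra.
have : n * slope x F' q h = 0 by lra.
by move=> /eqP; rewrite mulf_eq0 (negbTE n0) => /eqP.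
Qed.

(** When both functions are stationary the two focal rays are normal to the
    surface, so the point lies on the axis, to which the surface is normal. *)
Lemma doubly_stationary_axis q : U q -> stationary true q -> stationary false q ->
  [/\ dot (F' - F) (tangent0 x q) = 0, dot (F' - F) (tangent1 x q) = 0 &
      exists s, x q - F = s *: (F' - F)].
Proof.
move=> Uq st sf.
have orth F0 h : x q != F0 -> slope x F0 q h = 0 -> dot (x q - F0) ('D_h x q) = 0.
  rewrite -subr_eq0 -enorm_eq0 /slope => xF /eqP.
  by rewrite mulf_eq0 invr_eq0 (negbTE xF) orbF => /eqP.
have o h := orth F h (chart_neq chart SF Uq) (doubly_stationary h st sf).1.
have o' h := orth F' h (chart_neq chart SF' Uq) (doubly_stationary h st sf).2.
have FE : F' - F = (x q - F) + - (x q - F') by apply/rowP => i; rewrite !mxE; ring.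
have oD h : dot (F' - F) ('D_h x q) = 0.
  by rewrite FE (dotDl (x q - F)) (dotNl (x q - F')) o o' subrr.
split; [exact: oD|exact: oD|].
have g := tangent_independent chart Uq.
have [s es] := orth_plane g (o _) (o _).
have [s' es'] := orth_plane g (o' _) (o' _).
exists (s / (s - s')); rewrite FE es es' -scaleNr -scalerDl scalerA divfK//.
apply/eqP => ss'; case/eqP: FF'; apply/eqP; rewrite eq_sym -subr_eq0 FE es es'.
by rewrite -scaleNr -scalerDl ss' scale0r.
Qed.

Lemma doubly_stationary_isolated q : U q -> stationary true q -> stationary false q ->
  \forall a \near q, stationary true a /\ stationary false a -> a = q.
Proof.
move=> Uq st sf; have [t0 t1 [s xqE]] := doubly_stationary_axis Uq st sf.
apply: filterS2 (chart_near chart Uq) (isolated_orthogonal_line chart Uq t0 t1).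
move=> a Ua iso [sta sfa]; have [_ _ [s' xaE]] := doubly_stationary_axis Ua sta sfa.
apply: (iso (s' - s)); rewrite scalerBl -xqE -xaE.
by apply/rowP => i; rewrite !mxE; ring.
Qed.

(** Where only one of the two functions is stationary, the sign cannot change by
    continuity.  Around a point where both are, all other points are of the
    first kind, and they form a connected punctured square. *)
Lemma near_stationary q : U q -> exists e, \forall a \near q, stationary e a.
Proof.
move=> Uq.
have [[st sf]|nbad] := pselect (stationary true q /\ stationary false q); last first.
  have [e se] := lens_stationary Uq; exists e.
  by apply: filterS (stationary_locally_constant e Uq nbad) => a ->.
have /nbhs_ballP[r /= r0 Br] : \forall a \near q, U a /\
    (stationary true a /\ stationary false a -> a = q).
  apply: filterS2 (chart_near chart Uq) (doubly_stationary_isolated Uq st sf).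
  by move=> a.
have [b Bb bq] := exists_near_neq (nbhsx_ballx q r r0).
have [e se] := lens_stationary (Br b Bb).1.
exists e; apply/nbhs_ballP; exists r => //= a Ba.
have [->|aq] := eqVneq a q; first by case: e {se}.
apply: (punctured_locally_constant r0 _ Bb bq Ba aq se) => p Bp pq.
have [Up isop] := Br p Bp.
by apply: stationary_locally_constant => // /isop /eqP; exact/negP.
Qed.

End LensChart.

End Lens.

(** * Perfect lenses lie on ovals *)

Section Forward.
Variables (R : realType) (S : set 'rV[R]_3).
Hypotheses (S_smooth : smooth_surface S) (S_connected : connected S).
Implicit Types F : 'rV[R]_3.

Lemma focal_locally_constant (U : set 'rV[R]_2) x q F F' (m : R) :
  regular_chart S U x -> U q -> ~ S F -> ~ S F' ->
  (\forall a \near q, forall h, slope x F a h + m * slope x F' a h = 0) ->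
  \forall P \near x q, S P -> enorm (P - F) + m * enorm (P - F') =
                              enorm (x q - F) + m * enorm (x q - F').
Proof.
move=> chart Uq SF SF' stat.
apply: (near_chart chart (A := [set P | enorm (P - F) + m * enorm (P - F') = _]) Uq).
apply: (slope_focal_cst chart).
apply: filterS2 (chart_near chart Uq) stat => a Ua sa.
by split=> //; [exact: (chart_neq chart SF Ua)|exact: (chart_neq chart SF' Ua)].
Qed.

Lemma radial_sphere F : ~ S F ->
  (forall U x q, regular_chart S U x -> U q -> forall h, slope x F q h = 0) ->
  forall P Q, S P -> S Q -> enorm (Q - F) = enorm (P - F).
Proof.
move=> SF rad.
apply: (connected_cst S_connected) => P /S_smooth[U [x [chart [q Uq <-]]]].
have : \forall a \near q, forall h, slope x F a h + 0 * slope x F a h = 0.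
  by apply: filterS (chart_near chart Uq) => a Ua h; rewrite mul0r addr0 (rad U).
move=> /(focal_locally_constant chart Uq SF SF).
by apply: filterS => Q; rewrite !mul0r !addr0.
Qed.

Section TwoFoci.
Variables (F F' : 'rV[R]_3) (n : R).
Hypotheses (SF : ~ S F) (SF' : ~ S F') (FF' : F != F') (n0 : n != 0).
Hypothesis coplanar : forall P N, S P -> normal_vector S P N ->
  N \in <<[:: P - F; P - F']>>%VS.
Hypothesis snell : forall P N, S P -> normal_vector S P N ->
  sin (angle (P - F) N) = n * sin (angle (P - F') N).

Let f (e : bool) (P : 'rV[R]_3) :=
  enorm (P - F) + (-1) ^+ e * n * enorm (P - F').

Let locally_cst e := [set P | \forall Q \near P, S Q -> f e Q = f e P].

Lemma exists_locally_constant P : S P -> exists e, locally_cst e P.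
Proof.
move=> /S_smooth[U [x [chart [q Uq <-]]]].
have [e st] := near_stationary SF SF' coplanar snell chart FF' n0 Uq.
by exists e; exact: (focal_locally_constant chart Uq SF SF').
Qed.

Lemma near_locally_constant e P : locally_cst e P ->
  \forall Q \near P, S Q -> locally_cst e Q.
Proof.
move=> cP; have cP' : \forall Q \near P, \forall Q' \near Q, S Q' -> f e Q' = f e P.
  exact: near_join cP.
apply: filterS2 cP cP' => Q fQ cQ SQ.
by apply: filterS cQ => Q' /[apply] ->; rewrite fQ.
Qed.

(** Otherwise both functions would be stationary at all parameters near some
    [q], against [doubly_stationary_isolated]. *)
Lemma not_both_locally_constant P :
  S P -> locally_cst true P -> locally_cst false P -> False.
Proof.
move=> /S_smooth[U [x [chart [q Uq <-]]]] ct cf.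
have st e a : U a -> locally_cst e (x a) -> stationary F F' n x e a.
  move=> Ua ca; apply: (focal_cst_slope chart Ua (chart_neq chart SF Ua)
    (chart_neq chart SF' Ua) (c := f e (x a))).
  have cb : \forall b \near a, S (x b) -> f e (x b) = f e (x a).
    exact: (chart_continuous chart Ua ca).
  by apply: filterS2 (chart_near chart Ua) cb => b Ub; apply; exact: (chart_mem chart Ub).
have stnear e : locally_cst e (x q) -> \forall a \near q, stationary F F' n x e a.
  move=> ce; have ca : \forall a \near q, S (x a) -> locally_cst e (x a).
    exact: (chart_continuous chart Uq (near_locally_constant ce)).
  apply: filterS2 (chart_near chart Uq) ca => a Ua ca.
  by apply: st => //; apply: ca; exact: (chart_mem chart Ua).
have iso := doubly_stationary_isolated SF SF' chart FF' n0 Uq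
  (st _ _ Uq ct) (st _ _ Uq cf).
have [a [aq] /eqP] : exists2 a, a = q & a != q; last by rewrite aq.
apply: exists_near_neq; apply: filterS3 iso (stnear _ ct) (stnear _ cf).
by move=> a H sa sb; apply: H.
Qed.

Lemma one_focal_constant P0 : S P0 -> exists e, forall P, S P -> f e P = f e P0.
Proof.
move=> SP0; have [e ce] := exists_locally_constant SP0.
suff c P : S P -> locally_cst e P.
  exists e => P SP.
  by apply: (connected_cst (f := f e) S_connected _ SP0 SP) => Q /c.
move=> SP; apply: (connected_locally_constant S_connected _ SP0 SP ce) => Q SQ.
have [cQ|ncQ] := pselect (locally_cst e Q).
  by apply: filterS (near_locally_constant cQ) => Q' /[apply].
have {}cQ : locally_cst (~~ e) Q.
  by have [e' cQ] := exists_locally_constant SQ; case: e ncQ e' cQ {ce} => ncQ [].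
apply: filterS (near_locally_constant cQ) => Q' /[swap] SQ' /(_ SQ') cQ'.
split=> // cQ''; exfalso.
by case: e {ce ncQ cQ} cQ' cQ'' => c1 c2;
  [exact: (not_both_locally_constant SQ' c2 c1)
  |exact: (not_both_locally_constant SQ' c1 c2)].
Qed.

End TwoFoci.

Lemma lens_focal F F' : perfect_lens S F F' ->
  exists F1 F2 (m c : R), (m = 0 \/ F1 != F2) /\
    forall P, S P -> enorm (P - F1) + m * enorm (P - F2) = c.
Proof.
case=> SF SF' coplanar [n snell].
have [[P0 SP0]|S0] := pselect (exists P, S P); last first.
  by exists 0, 0, 0, 0; split=> [|P SP]; [left|case: S0; exists P].
have sphere : (forall U x q, regular_chart S U x -> U q -> forall h, slope x F q h = 0) ->
    exists F1 F2 (m c : R), (m = 0 \/ F1 != F2) /\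
    forall P, S P -> enorm (P - F1) + m * enorm (P - F2) = c.
  move=> rad; exists F, F, 0, (enorm (P0 - F)); split=> [|P SP]; first by left.
  by rewrite mul0r addr0; exact: (radial_sphere SF rad).
have [n0|n0] := eqVneq n 0.
  apply: sphere => U x q chart Uq h.
  have [e /(_ h)] := lens_stationary SF SF' coplanar snell chart Uq.
  by rewrite n0 mulr0 mul0r addr0.
have [FF'|FF'] := eqVneq F F'.
  (* the normal is a multiple of the only ray *)
  apply: sphere => U x q chart Uq h.
  have Nq := cross_tangent_normal chart Uq.
  have /mem_span2P[s [t]] := coplanar _ _ (chart_mem chart Uq) Nq.
  rewrite -FF' -scalerDl => NE.
  have : dot (cross (tangent0 x q) (tangent1 x q)) ('D_h x q) = 0.
    by rewrite (tangent_decomp chart h Uq) dot_comb dot_crossl dot_crossr !mulr0 addr0.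
  rewrite NE dotZl => /eqP; rewrite mulf_eq0 => /orP[/eqP st0|/eqP].
    by case: Nq => /eqP; rewrite NE st0 scale0r.
  by rewrite /slope => ->; rewrite mul0r.
have [e oval] := one_focal_constant SF SF' FF' n0 coplanar snell SP0.
by do 4 eexists; split; [right; exact: FF'|exact: oval].
Qed.

End Forward.

(** * Surfaces of revolution of ovals *)

Section Revolution.
Variable R : realType.
Implicit Types (O P u v w : 'rV[R]_3) (e : 'I_3 -> 'rV[R]_3) (b m c : R).

Lemma frame_expand e v : orthonormal_frame e ->
  v = dot v (e 0) *: e 0 + dot v (e 1) *: e 1 + dot v (e 2%:R) *: e 2%:R.
Proof.
move=> fe; pose M : 'M[R]_3 := \matrix_i e i.
have MMT : M *m M^T = 1%:M.
  apply/matrixP => i j; rewrite !mxE -fe /dot; apply: eq_bigr => k _.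
  by rewrite !mxE.
have vE : v = (v *m M^T) *m M by rewrite -mulmxA (mulmx1C MMT) mulmx1.
have dotE i : (v *m M^T) 0 i = dot v (e i).
  by rewrite mxE /dot; apply: eq_bigr => k _; rewrite !mxE.
rewrite [LHS]vE mulmx_sum_row; under eq_bigr do rewrite dotE rowK.
rewrite !big_ord_recr big_ord0 /= add0r.
by congr (_ + _ + _); congr (dot v (e _) *: e _); apply: val_inj.
Qed.

Lemma exists_frame v : exists2 e, orthonormal_frame e & v = enorm v *: e 0.
Proof.
have [w w1 vw] : exists2 w : 'rV[R]_3, dot w w = 1 & v = enorm v *: w.
  have [->|v0] := eqVneq v 0.
    exists (delta_mx 0 0); last by rewrite enorm0 scale0r.
    by rewrite dot3E !mxE /=; ring.
  have nv : enorm v != 0 by rewrite enorm_eq0.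
  exists ((enorm v)^-1 *: v); last by rewrite scalerA divff// scale1r.
  by rewrite !dot_linear -enorm_sqr; field.
have [z gz] : exists z : 'rV[R]_3, gram w z != 0.
  have dotE (u : 'rV[R]_3) i : dot u (delta_mx 0 i) = u 0 i.
    rewrite /dot (bigD1 i)//= big1 ?addr0 => [|j ji]; first by rewrite mxE !eqxx mulr1.
    by rewrite mxE (negbTE ji) mulr0.
  have gE (i : 'I_3) : gram w (delta_mx 0 i) = 1 - w 0 i ^+ 2.
    by rewrite /gram w1 mul1r !dotE mxE !eqxx.
  move: w1; rewrite dot3E => w1.
  have [g0|g0] := eqVneq (gram w (delta_mx 0 0)) 0; last by eexists; exact: g0.
  have [g1|g1] := eqVneq (gram w (delta_mx 0 1)) 0; last by eexists; exact: g1.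
  by exfalso; move: g0 g1; rewrite !gE; nra.
pose u := (enorm (cross w z))^-1 *: cross w z.
have uu : dot u u = 1.
  have nc : enorm (cross w z) != 0 by rewrite enorm_eq0 -dot_eq0 dot_cross.
  by rewrite !dot_linear -enorm_sqr; field.
have uw : dot u w = 0 by rewrite dotZl dot_crossl mulr0.
have gwu : gram w u = 1 by rewrite /gram w1 uu (dotC w) uw; ring.
exists (fun i => [:: w; u; cross w u]`_i) => //.
have wc : dot w (cross w u) = 0 by rewrite dotC dot_crossl.
have uc : dot u (cross w u) = 0 by rewrite dotC dot_crossr.
move=> [[|[|[|//]]] i] [[|[|[|//]]] j] /=;
by rewrite ?w1 ?uu ?uw ?wc ?uc ?dot_cross ?dot_crossl ?dot_crossr // dotC.
Qed.

Lemma polar b c : exists rho phi : R, b = rho * cos phi /\ c = rho * sin phi.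
Proof.
pose rho := Num.sqrt (b ^+ 2 + c ^+ 2).
have ge : 0 <= b ^+ 2 + c ^+ 2 by rewrite addr_ge0 ?sqr_ge0.
have rhoE : rho ^+ 2 = b ^+ 2 + c ^+ 2 by rewrite sqr_sqrtr.
have rho0 : 0 <= rho by exact: sqrtr_ge0.
have [r0|r0] := eqVneq rho 0.
  by exists 0, 0; move: rhoE; rewrite r0; split; nra.
have rp : 0 < rho by rewrite lt_def r0.
have bound : -1 <= b / rho <= 1.
  by rewrite ler_pdivlMr// ler_pdivrMr//; apply/andP; split; nra.
have sE : rho * sin (acos (b / rho)) = `|c|.
  rewrite sin_acos// (_ : 1 - _ = (c / rho) ^+ 2).
    by rewrite sqrtr_sqr normrM normfV (ger0_norm rho0) mulrC divfK.
  by rewrite !expr_div_n rhoE; field; rewrite -rhoE sqrf_eq0.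
exists rho; have [c0|c0] := leP 0 c.
  exists (acos (b / rho)); rewrite acosK ?in_itv// sE ger0_norm//; split=> //.
  by rewrite mulrC divfK.
exists (- acos (b / rho)); rewrite cosN sinN acosK ?in_itv// mulrN sE ltr0_norm//.
by rewrite opprK mulrC divfK.
Qed.

Lemma row2_dot (p q : 'rV[R]_2) : dot p q = p 0 0 * q 0 0 + p 0 1 * q 0 1.
Proof.
rewrite /dot !big_ord_recr big_ord0 /= add0r.
by congr (_ + _); congr (p 0 _ * q 0 _); apply: val_inj.
Qed.

Lemma enorm_cylindrical e (s t phi : R) (p : 'rV[R]_2) : orthonormal_frame e ->
  p 0 0 = s -> p 0 1 = t ->
  enorm (s *: e 0 + t *: (cos phi *: e 1 + sin phi *: e 2%:R)) = enorm p.
Proof.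
move=> fe <- <-; rewrite /enorm; congr (Num.sqrt _).
rewrite row2_dot !dot_linear !fe /=.
have := cos2Dsin2 phi; move: (cos phi) (sin phi) => C D CD.
transitivity (p 0 0 * p 0 0 + p 0 1 * p 0 1 * (C ^+ 2 + D ^+ 2)); first by ring.
by rewrite CD mulr1.
Qed.

(** The distances from a point to the foci, which lie on the axis, are those in
    the meridian plane of the point. *)
Lemma revolve_cartesian O e b m c P : orthonormal_frame e ->
  revolve O e (cartesian_locus 0 (b *: 'e_0) m c) P <->
  enorm (P - O) + m * enorm (P - (O + b *: e 0)) = c.
Proof.
move=> fe.
have key (s t phi : R) (p : 'rV[R]_2) : p 0 0 = s -> p 0 1 = t ->
    P = O + s *: e 0 + t *: (cos phi *: e 1 + sin phi *: e 2%:R) ->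
    enorm (P - O) = enorm (p - 0) /\
    enorm (P - (O + b *: e 0)) = enorm (p - b *: 'e_0).
  move=> ps pt ->; split.
    rewrite subr0 -(enorm_cylindrical phi fe ps pt); congr enorm.
    by apply/rowP => i; rewrite !mxE; ring.
  rewrite -(enorm_cylindrical phi fe (s := s - b) (t := t)); last 2 first.
  - by rewrite !mxE /= mulr1 ps.
  - by rewrite !mxE /= mulr0 subr0 pt.
  congr enorm; rewrite scalerBl; apply/rowP => i; rewrite !mxE; ring.
split=> [[p [phi [Cp PE]]]|PE].
  by have [-> ->] := key _ _ phi p erefl erefl PE.
have [rho [phi [r1 r2]]] := polar (dot (P - O) (e 1)) (dot (P - O) (e 2%:R)).
pose p : 'rV[R]_2 := \row_i [:: dot (P - O) (e 0); rho]`_i.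
have p0 : p 0 0 = dot (P - O) (e 0) by rewrite mxE.
have p1 : p 0 1 = rho by rewrite mxE.
have Pp : P = O + p 0 0 *: e 0 + p 0 1 *: (cos phi *: e 1 + sin phi *: e 2%:R).
  rewrite p0 p1 scalerDr !scalerA -r1 -r2 -!addrA [_ *: e 1 + _]addrC.
  have := frame_expand (P - O) fe; rewrite -addrA [_ *: e 1 + _]addrC => <-.
  by rewrite addrC subrK.
exists p, phi; split=> //.
by rewrite /cartesian_locus /=; have [<- <-] := key _ _ phi p erefl erefl Pp.
Qed.

(** The equation fails at one of the points [0], [1], [b], [2 b] of the axis. *)
Lemma cartesian_locus_neqT b m c : m = 0 \/ b != 0 ->
  cartesian_locus 0 (b *: 'e_0) m c <> setT.
Proof.
move=> mb full.
have locus (s : R) : `|s| + m * `|s - b| = c.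
  have : cartesian_locus 0 (b *: 'e_0) m c (s *: 'e_0) by rewrite full.
  rewrite /cartesian_locus /= subr0 -scalerBl !enormZ.
  have -> : enorm ('e_0 : 'rV[R]_2) = 1.
    by rewrite /enorm row2_dot !mxE /= !mulr0 addr0 mulr1 sqrtr1.
  by rewrite !mulr1.
case: mb => [m0|b0].
  have := locus 0; have := locus 1; rewrite m0 normr0 normr1; lra.
have := locus 0; have := locus b; have := locus (b + b).
rewrite addrK subrr sub0r normrN !normr0.
have : 0 < `|b| by rewrite normr_gt0.
have -> : `|b + b| = 2 * `|b| by rewrite -mulr2n normrMn mulr_natl.
move: `|b| => B; nra.
Qed.

End Revolution.

(** * What a surface cannot contain *)

Lemma coord_le_enorm (R : realType) (k : nat) (v : 'rV[R]_k) i : `|v 0 i| <= enorm v.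
Proof.
rewrite -(@ler_pXn2r _ 2) ?nnegrE ?enorm_ge0// enorm_sqr real_normK ?num_real//.
rewrite /dot (bigD1 i)//= -expr2 lerDl.
by apply: sumr_ge0 => j _; rewrite -expr2 sqr_ge0.
Qed.

Section Backward.
Variables (R : realType) (S : set 'rV[R]_3) (U : set 'rV[R]_2).
Variable x : 'rV[R]_2 -> 'rV[R]_3.
Hypothesis chart : regular_chart S U x.
Implicit Types (q h : 'rV[R]_2) (A B F : 'rV[R]_3).

Lemma near_chart_neq q B : U q -> x q != B -> \forall a \near q, x a != B.
Proof.
move=> Uq qB; have L : nbhs (x q) [set P | P != B].
  apply/nbhs_ballP; exists `|x q - B|; first by rewrite /= normr_gt0 subr_eq0.
  move=> P; rewrite -ball_normE /ball_ /= => Pq; apply/eqP => e.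
  by rewrite e ltxx in Pq.
exact: (chart_continuous chart Uq L).
Qed.

(** Near [q] the right-hand side is differentiable, while the left-hand side
    bounds each coordinate of [x a - A] and vanishes at [q]: by
    [derive_dominated] all derivatives of [x] at [q] would be [0]. *)
Lemma focus_off_surface q A B (k m : R) : U q -> x q = A -> A != B ->
  ~ (\forall a \near q, enorm (x a - A) = k + m * enorm (x a - B)).
Proof.
move=> Uq qA AB dist; have xqB : x q != B by rewrite qA.
have tangent_null h : 'D_h x q = 0.
  have e0 : q + 0 *: h = q by rewrite scale0r addr0.
  pose good a := [/\ U a, x a != B & enorm (x a - A) = k + m * enorm (x a - B)].
  have : \forall t \near (0 : R), good (q + t *: h).
    have L : nbhs (q + 0 *: h) [set a | good a].
      rewrite e0; apply: filterS3 (chart_near chart Uq) (near_chart_neq Uq xqB) dist.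
      by move=> a; split.
    exact: (@line_continuous R q h 0 _ L).
  move=> /near_join /nbhs_ballP[d /= d0 Bd].
  apply/rowP => i; rewrite (chart_dE chart h Uq).
  have dcoord (t : R) : U (q + t *: h) -> is_derive t 1
      (fun s => (x (q + s *: h) - A) 0 i) ('d x (q + t *: h) h 0 i).
    move=> Ut; have H := is_derive_line (is_derive_coord h i (chart_differentiable chart Ut)).
    rewrite (_ : (fun s : R => _) = (fun s => x (q + s *: h) 0 i) - cst (A 0 i)).
      by rewrite -[X in is_derive _ _ _ X]subr0; apply: is_deriveB.
    by apply/funext => s /=; rewrite !mxE.
  have D0 : 'D_1 (fun s : R => (x (q + s *: h) - A) 0 i) (0 : R) = 0.
    apply: (derive_dominated (f := fun s => enorm (x (q + s *: h) - A)) d0); last first.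
      by rewrite e0 qA subrr enorm0.
    move=> t td; have goodt : \forall s \near t, good (q + s *: h).
      by apply: Bd; rewrite -ball_normE /ball_ /= sub0r normrN ltr_norml.
    have [Ut tB tE] := nbhs_singleton goodt.
    split; [|by case: (dcoord t Ut)|exact: coord_le_enorm].
    have D := is_derive_dist (chart_differentiable chart Ut) tB.
    have [D' _] := is_deriveD (is_derive_cst k t 1) (is_deriveZ m D).
    apply: near_eq_derivable D'.
    by apply: filterS goodt => s [_ _ ->].
  have := dcoord 0; rewrite e0 => /(_ Uq) [_ <-].
  by rewrite D0 mxE.
have := tangent_independent chart Uq.
rewrite /tangent0 tangent_null; move: (tangent1 x q) => w /eqP; apply.
by rewrite /gram !dot3E !mxE; ring.
Qed.

(** Linear forms that vanish on [D] are constant on the image of [x], hence vanish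
    on the tangent vectors, which would all be multiples of [D]. *)
Lemma chart_not_in_line q F D : U q -> D != 0 ->
  ~ (forall a, U a -> exists s, x a - F = s *: D).
Proof.
move=> Uq D0 line.
have functional y h : dot y D = 0 -> dot y ('D_h x q) = 0.
  move=> yD.
  have cst_yx : \forall a \near q, dot y (x a) = dot y F.
    apply: filterS (chart_near chart Uq) => a /line[s e].
    by rewrite -[x a](subrK F) e dotDr dotZr yD mulr0 add0r.
  have coord i : is_derive q h (fun a => x a 0 i) ('D_h x q 0 i).
    rewrite (chart_dE chart h Uq); apply: is_derive_coord.
    exact: (chart_differentiable chart Uq).
  have := @is_derive_sum _ _ _ 3 (fun i => y 0 i *: (fun a => x a 0 i)) q h
    (fun i => y 0 i *: 'D_h x q 0 i) (fun i => is_deriveZ (y 0 i) (coord i)).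
  set f := (X in is_derive _ _ X _) => -[_].
  rewrite (near_eq_derive (g := cst (dot y F)) (f := f)) ?derive_cst.
    by move=> e; rewrite [RHS]e.
  by apply: filterS cst_yx => a; rewrite /f fct_sumE.
have gramD h : gram D ('D_h x q) = 0.
  (* the component of ['D_h x q] orthogonal to [D], up to a factor *)
  have := functional (dot D D *: 'D_h x q - dot D ('D_h x q) *: D) h.
  rewrite /gram; move: ('D_h x q) => w.
  rewrite !dot_linear (dotC w D) => H; rewrite expr2; apply: H; ring.
have prop h : exists s, 'D_h x q = s *: D.
  by eexists; apply: gram_eq0 => //; rewrite gramC.
have [s es] := prop (delta_mx 0 0); have [t et] := prop (delta_mx 0 1).
have := tangent_independent chart Uq; rewrite /tangent0 /tangent1 es et => /eqP; apply.
by rewrite gramZl gramZr /gram; ring.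
Qed.

Lemma normal_cross q N : U q -> N != 0 -> (forall w, dot N ('d x q w) = 0) ->
  exists2 s, s != 0 & cross (tangent0 x q) (tangent1 x q) = s *: N.
Proof.
move=> Uq N0 Nw; have g := tangent_independent chart Uq.
have Nt h : dot N ('D_h x q) = 0 by rewrite (chart_dE chart h Uq).
have [s e] := orth_plane g (Nt _) (Nt _).
have s0 : s != 0 by apply: contraNneq N0 => s0; rewrite e s0 scale0r.
by exists s^-1; [rewrite invr_eq0|rewrite e scalerA mulVf// scale1r].
Qed.

End Backward.

(** * Ovals are perfect lenses *)

Section Degenerate.
Variable R : realType.
Implicit Types a b : 'rV[R]_3.

(** The case where [u + m v] fails to give a normal: the two rays are
    parallel, and the triangle formed by the point and the two foci is flat. *)
Lemma opposite_rays a b (m : R) : a != 0 -> b != 0 ->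
  (enorm a)^-1 *: a + m *: ((enorm b)^-1 *: b) = 0 ->
  m ^+ 2 = 1 /\ (enorm a + m * enorm b) ^+ 2 = dot (a - b) (a - b).
Proof.
move=> a0 b0; have na : enorm a != 0 by rewrite enorm_eq0.
have nb : enorm b != 0 by rewrite enorm_eq0.
have [u uu aE] : exists2 u, dot u u = 1 & a = enorm a *: u.
  exists ((enorm a)^-1 *: a); last by rewrite scalerA divff// scale1r.
  by rewrite dotZl dotZr -enorm_sqr; field.
have [v vv bE] : exists2 v, dot v v = 1 & b = enorm b *: v.
  exists ((enorm b)^-1 *: b); last by rewrite scalerA divff// scale1r.
  by rewrite dotZl dotZr -enorm_sqr; field.
move: (enorm a) (enorm b) na nb aE bE => A B A0 B0 -> ->.
rewrite !scalerA -mulrA !mulVf// mulr1 scale1r => /eqP; rewrite addr_eq0 => /eqP uE.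
move: uE uu => ->; rewrite dotNl dotNr opprK dotZl dotZr vv mulr1 -expr2 => m1.
split=> //; rewrite !dot_linear vv.
rewrite -[X in _ = X]subr0; apply/eqP; rewrite -subr_eq0; apply/eqP.
transitivity ((1 - m ^+ 2) * (A ^+ 2 - B ^+ 2)); first by ring.
by rewrite m1; ring.
Qed.

(** Equality in the triangle inequality forces collinearity. *)
Lemma triangle_equality_gram a b (m : R) : m ^+ 2 = 1 ->
  (enorm a + m * enorm b) ^+ 2 = dot (a - b) (a - b) -> gram a (a - b) = 0.
Proof.
move=> m1 e.
have ab : dot a b = - m * (enorm a * enorm b).
  have := enorm_sqr a; have := enorm_sqr b.
  move: e; rewrite !dot_linear (dotC b a).
  move: (enorm a) (enorm b) (dot a a) (dot b b) (dot a b) => A B aa bb ab e BB AA.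
  have : A ^+ 2 + 2 * m * A * B + m ^+ 2 * B ^+ 2 = (A + m * B) ^+ 2 by ring.
  by rewrite e m1 -AA -BB; lra.
rewrite /gram !dot_linear (dotC b a) ab -!enorm_sqr.
transitivity ((1 - m ^+ 2) * (enorm a * enorm b) ^+ 2); first by ring.
by rewrite m1; ring.
Qed.

End Degenerate.

Section FocalLens.
Variables (R : realType) (S : set 'rV[R]_3).
Hypothesis S_smooth : smooth_surface S.
Implicit Types F : 'rV[R]_3.

Lemma sphere_lens F (r : R) : (forall P, S P -> enorm (P - F) = r) ->
  perfect_lens S F F.
Proof.
move=> sphere.
have SF : ~ S F.
  move=> /[dup] /S_smooth[U [x [chart [q Uq qF]]]] _.
  (* the second point is arbitrary, as the coefficient of its distance is [0] *)
  have FF : F != F + delta_mx 0 0.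
    rewrite -subr_eq0 opprD addrA subrr sub0r oppr_eq0.
    by apply/eqP => /rowP /(_ 0) /eqP; rewrite !mxE /= oner_eq0.
  apply: (focus_off_surface chart Uq qF FF (k := r) (m := 0)).
  apply: filterS (chart_near chart Uq) => a Ua.
  by rewrite mul0r addr0 sphere//; exact: (chart_mem chart Ua).
split=> //; last by exists 1 => P N _ _; rewrite mul1r.
move=> P N _ [N0 [U [x [q [chart Uq <- Nw]]]]].
have xF := chart_neq chart SF Uq.
have dist : \forall a \near q, enorm (x a - F) + 0 * enorm (x a - F) = r.
  apply: filterS (chart_near chart Uq) => a Ua.
  by rewrite mul0r addr0 sphere//; exact: (chart_mem chart Ua).
have orth h : dot (x q - F) ('D_h x q) = 0.
  have /eqP := focal_cst_slope chart Uq xF xF dist h.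
  rewrite mul0r addr0 /slope mulf_eq0 invr_eq0 enorm_eq0 subr_eq0 (negbTE xF) orbF.
  by move/eqP.
have [s s0 cE] := normal_cross chart Uq N0 Nw.
have [t tE] := orth_plane (tangent_independent chart Uq) (orth _) (orth _).
have t0 : t != 0 by apply: contraNneq xF => t0; rewrite -subr_eq0 tE t0 scale0r.
apply/mem_span2P; exists (t * s)^-1, 0.
by rewrite scale0r addr0 tE cE !scalerA -mulrA mulVf ?scale1r ?mulf_neq0.
Qed.

Lemma focal_lens F F' (m c : R) : F != F' -> m != 0 ->
  (forall P, S P -> enorm (P - F) + m * enorm (P - F') = c) ->
  perfect_lens S F F'.
Proof.
move=> FF' m0 oval.
have SF : ~ S F.
  move=> /[dup] /S_smooth[U [x [chart [q Uq qF]]]] _.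
  apply: (focus_off_surface chart Uq qF FF' (k := c) (m := - m)).
  apply: filterS (chart_near chart Uq) => a Ua.
  by rewrite -(oval _ (chart_mem chart Ua)); ring.
have SF' : ~ S F'.
  move=> /[dup] /S_smooth[U [x [chart [q Uq qF]]]] _.
  rewrite eq_sym in FF'.
  apply: (focus_off_surface chart Uq qF FF' (k := c / m) (m := - m^-1)).
  apply: filterS (chart_near chart Uq) => a Ua.
  by rewrite -(oval _ (chart_mem chart Ua)); field.
have main P N : S P -> normal_vector S P N ->
    N \in <<[:: P - F; P - F']>>%VS /\
    sin (angle (P - F) N) = `|m| * sin (angle (P - F') N).
  move=> _ [N0 [U [x [q [chart Uq <- Nw]]]]].
  have xF := chart_neq chart SF Uq; have xF' := chart_neq chart SF' Uq.
  have dist : \forall a \near q, enorm (x a - F) + m * enorm (x a - F') = c.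
    by apply: filterS (chart_near chart Uq) => a Ua; exact: oval (chart_mem chart Ua).
  (* the gradient of [d + m d'] *)
  pose M := (enorm (x q - F))^-1 *: (x q - F) +
            m *: ((enorm (x q - F'))^-1 *: (x q - F')).
  have orth h : dot M ('D_h x q) = 0.
    rewrite -(focal_cst_slope chart Uq xF xF' dist h) /M /slope.
    move: (x q - F) (x q - F') ('D_h x q) => a b w.
    by rewrite dotDl !dotZl; ring.
  rewrite -subr_eq0 in xF; rewrite -subr_eq0 in xF'.
  have [M0|M0] := eqVneq M 0.
    exfalso; have [m1 tri] := opposite_rays xF xF' M0.
    have DE a : (x a - F) - (x a - F') = F' - F.
      by apply/rowP => i; rewrite !mxE; ring.
    have D0 : F' - F != 0 by rewrite subr_eq0 eq_sym.
    apply: (chart_not_in_line chart (F := F) Uq D0) => a Ua; eexists.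
    apply: (gram_eq0 D0); rewrite -(DE a); apply: (triangle_equality_gram m1).
    by rewrite (oval _ (chart_mem chart Ua)) -(oval _ (chart_mem chart Uq)) tri !DE.
  have [s s0 cE] := normal_cross chart Uq N0 Nw.
  have [t tE] := orth_plane (tangent_independent chart Uq) (orth _) (orth _).
  have t0 : t != 0 by apply: contraNneq M0 => t0; rewrite tE t0 scale0r.
  apply: (tangent_snell (s := (t * s)^-1) (m := m) xF xF' N0).
  by rewrite -/M tE cE !scalerA mulVf ?scale1r ?mulf_neq0.
split=> //; first by move=> P N SP PN; have [] := main P N SP PN.
by exists `|m| => P N SP PN; have [] := main P N SP PN.
Qed.

End FocalLens.

(** * Descartes' theorem *)

Theorem theorem1 (R : realType) (S : set 'rV[R]_3)
    (S_smooth : smooth_surface S) (S_connected : connected S) :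
  (exists F F' : 'rV[R]_3, perfect_lens S F F') <->
  (exists T : set 'rV[R]_3, [/\ cartesian_ovoid T, connected S & S `<=` T]).
Proof.
split=> [[F [F' lens]]|[_ [[F [e [_ [fe [b [m [c [b0 -> CT]]]] ->]]]] _ ST]]].
  have [F1 [F2 [m [c [mF oval]]]]] := lens_focal S_smooth S_connected lens.
  have [e fe De] := exists_frame (F2 - F1).
  exists (revolve F1 e (cartesian_locus 0 (enorm (F2 - F1) *: 'e_0) m c)).
  split=> // [|P SP].
    exists F1, e, (cartesian_locus 0 (enorm (F2 - F1) *: 'e_0) m c); split=> //.
    exists (enorm (F2 - F1)), m, c; split=> //; first exact: enorm_ge0.
    apply: cartesian_locus_neqT; case: mF => [|F12]; [by left|right].
    by rewrite enorm_eq0 subr_eq0 eq_sym.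
  by apply/revolve_cartesian => //; rewrite -De [F1 + _]addrC subrK oval.
have oval P : S P -> enorm (P - F) + m * enorm (P - (F + b *: e 0)) = c.
  by move=> /ST /(revolve_cartesian F b m c P fe).
have [bm0|] := boolP ((b == 0) || (m == 0)); last first.
  rewrite negb_or => /andP[bn0 mn0]; exists F, (F + b *: e 0).
  apply: (focal_lens S_smooth _ mn0 oval).
  rewrite -subr_eq0 opprD addrA subrr sub0r oppr_eq0 scaler_eq0 negb_or bn0.
  by rewrite -dot_eq0 fe eqxx oner_eq0.
exists F, F; case/orP: bm0 => [/eqP b00|/eqP m0]; last first.
  by apply: (sphere_lens S_smooth (r := c)) => P /oval; rewrite m0 mul0r addr0.
have {}oval P : S P -> (1 + m) * enorm (P - F) = c.
  by move=> /oval; rewrite b00 scale0r addr0 mulrDl mul1r.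
(* if [1 + m = 0] the locus is the whole plane or empty *)
have [m1|m1] := eqVneq (1 + m) 0.
  apply: (sphere_lens S_smooth (r := 0)) => P /oval; rewrite m1 mul0r => c0.
  case: CT; apply/seteqP; split=> // p _; rewrite /cartesian_locus /=.
  by rewrite b00 scale0r -[X in X + _]mul1r -mulrDl m1 mul0r.
apply: (sphere_lens S_smooth (r := c / (1 + m))) => P /oval <-.
by rewrite mulrC mulKf.
Qed.
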